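(* Let $\mathcal{X}$ be a finite-dimensional real Hilbert space, $n\ge 1$, $L>0$, $\tau\in[0,L]$, and let $f_1,\dots,f_n:\mathcal{X}\to\mathbb{R}$ be $L$-smooth and $\tau$-weakly convex functions. Let $f=\frac1n\sum_{i=1}^n f_i$, suppose that $f^\star=\inf f>-\infty$, and suppose that $f$ is $\mu$-PŁ for some $\mu>0$. Let $(x^t,g^t)_{t\ge0}$ be generated by the algorithm PAGE with probability $p\in(0,1]$, initial points $x^0,g^0\in\mathcal{X}$, and stepsize $\gamma>0$ satisfying $$\gamma\le\frac{1}{L\left(1+\sqrt{\frac{4\tau}{L+\tau}}\sqrt{\frac{1-p}{p}}\right)},$$ with the additional requirement $\gamma<\frac1L$ if $\tau=0$. Set $$a=1-\frac{\gamma(L-\tau)}{2}\in\left(\tfrac12,1\right],\qquad b=\frac{\gamma(L-\tau)}{2}\in\left[0,\tfrac12\right),$$ and, for every $t\ge0$, $$\Psi^t=f(x^t)-f^\star-b\gamma\|\nabla f(x^t)\|^2+\frac{a\gamma}{p}\|g^t-\nabla f(x^t)\|^2+\frac{b\gamma}{p}\|g^t\|^2 .$$ Then $b\gamma<\frac{1}{2L}$, and for every $t\ge0$, $$\mathbb{E}[\Psi^t]\le\rho^t\,\Psi^0,\qquad\text{where}\quad \rho=\max\left(1-(1-2b)\gamma\mu,\;1-p\left(1-\frac{1}{2a}\right)\right)<1 .$$ Moreover, $\Psi^t\to0$ almost surely as $t\to\infty$.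
   Context: A function $h:\mathcal{X}\to\mathbb{R}$ is $L$-smooth if it is differentiable on $\mathcal{X}$ and $\|\nabla h(x)-\nabla h(y)\|\le L\|x-y\|$ for all $x,y\in\mathcal{X}$. It is $\tau$-weakly convex if $h+\frac{\tau}{2}\|\cdot\|^2$ is convex. The function $f$ with $f^\star=\inf f>-\infty$ is $\mu$-PŁ (Polyak–Łojasiewicz) if $\|\nabla f(x)\|^2\ge2\mu(f(x)-f^\star)$ for every $x\in\mathcal{X}$. No minimizer of $f$ is assumed to exist. Algorithm PAGE. Inputs: (deterministic) $x^0,g^0\in\mathcal{X}$, stepsize $\gamma>0$, probability $p\in(0,1]$. For $t=0,1,2,\dots$: set $x^{t+1}=x^t-\gamma g^t$. Draw $\theta^t\in\{0,1\}$ with $\mathbb{P}(\theta^t=1)=p$, and $i^t$ uniformly at random in $\{1,\dots,n\}$. If $\theta^t=0$, set $g^{t+1}=g^t+\nabla f_{i^t}(x^{t+1})-\nabla f_{i^t}(x^t)$; if $\theta^t=1$, set $g^{t+1}=\nabla f(x^{t+1})$. All the random variables $\theta^0,i^0,\theta^1,i^1,\dots$ are mutually independent. *)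

(* Defs.v *)
From mathcomp Require Import all_boot all_order all_algebra sesquilinear.
From mathcomp Require Import all_classical all_reals all_analysis.
Set Implicit Arguments.
Unset Strict Implicit.
Unset Printing Implicit Defensive.
Import Order.TTheory GRing.Theory Num.Theory.
Import numFieldNormedType.Exports.
Local Open Scope classical_set_scope.
Local Open Scope ring_scope.

Definition finite_dimensional (R : realType) (X : normedModType R) : Prop :=
  exists (m : nat) (e : 'I_m -> X),
    forall x, exists c : 'I_m -> R, x = \sum_(k < m) c k *: e k.

(* The norm of the normed space X is the one of the inner product, so that X is
   a pre-Hilbert space; completeness is automatic in finite dimension. *)
Definition hilbert_norm (R : realType) (X : normedModType R)
    (dot : {dot X for @idfun R}) : Prop :=
  forall x : X, `|x| ^+ 2 = dot x x.

(* Riesz representative of the Frechet differential; meaningful only where h is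
   differentiable. *)
Definition gradient (R : realType) (X : normedModType R)
    (dot : {dot X for @idfun R}) (h : X -> R) (x : X) : X :=
  get [set g : X | forall v, 'd h x v = dot g v].

Definition smooth (R : realType) (X : normedModType R)
    (dot : {dot X for @idfun R}) (L : R) (h : X -> R) : Prop :=
  (forall x, differentiable h x) /\
  (forall x y, `|gradient dot h x - gradient dot h y| <= L * `|x - y|).

Definition weakly_convex (R : realType) (X : normedModType R)
    (tau : R) (h : X -> R) : Prop :=
  convex_function [set: convex_lmodType X]
    (fun x : X => h x + tau / 2 * `|x| ^+ 2).

Definition polyak_lojasiewicz (R : realType) (X : normedModType R)
    (dot : {dot X for @idfun R}) (mu : R) (h : X -> R) : Prop :=
  forall x, 2 * mu * (h x - inf (range h)) <= `|gradient dot h x| ^+ 2.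

Definition average (R : realType) (X : Type) (n : nat) (fs : 'I_n -> X -> R)
    (x : X) : R :=
  n%:R^-1 * \sum_(k < n) fs k x.

(* The sigma-algebra generated by a random variable with values in a set E
   carrying the discrete sigma-algebra (here E is bool or 'I_n; the latter has
   no measurableType structure since it may be empty). *)
Definition sigma_of (T E : Type) (Y : T -> E) : set (set T) :=
  preimage_set_system [set: T] Y discrete_measurable.

Definition mutually_independent (d : measure_display) (T : measurableType d)
    (R : realType) (P : probability T R) (I : eqType)
    (F : I -> set (set T)) : Prop :=
  forall (J : seq I) (A : I -> set T), uniq J ->
    (forall j, j \in J -> F j (A j)) ->
    P (\bigcap_(j in [set` J]) A j) = (\prod_(j <- J) P (A j))%E.

(* The joint family theta^0, i^0, theta^1, i^1, ... is indexed by nat + nat: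
   inl t stands for theta^t and inr t for i^t. *)
Definition page_sigma (T : Type) (n : nat) (theta : nat -> T -> bool)
    (idx : nat -> T -> 'I_n) (j : nat + nat) : set (set T) :=
  match j with
  | inl t => sigma_of (theta t)
  | inr t => sigma_of (idx t)
  end.

Definition page_noise (d : measure_display) (T : measurableType d)
    (R : realType) (P : probability T R) (p : R) (n : nat)
    (theta : nat -> T -> bool) (idx : nat -> T -> 'I_n) : Prop :=
  (forall t, sigma_of (theta t) `<=` measurable) /\
  (forall t, sigma_of (idx t) `<=` measurable) /\
  (forall t, P [set w | theta t w = true] = p%:E) /\
  (forall t k, P [set w | idx t w = k] = (n%:R^-1)%:E) /\
  mutually_independent P (page_sigma theta idx).

(* The state is the pair (x^t, g^t). *)
Definition page_step (R : realType) (X : normedModType R)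
    (dot : {dot X for @idfun R}) (n : nat) (fs : 'I_n -> X -> R) (gamma : R)
    (theta : bool) (k : 'I_n) (s : X * X) : X * X :=
  let x := s.1 - gamma *: s.2 in
  (x, if theta then gradient dot (average fs) x
      else s.2 + gradient dot (fs k) x - gradient dot (fs k) s.1).

Fixpoint page (R : realType) (X : normedModType R)
    (dot : {dot X for @idfun R}) (n : nat) (fs : 'I_n -> X -> R) (gamma : R)
    (T : Type) (theta : nat -> T -> bool) (idx : nat -> T -> 'I_n)
    (x0 g0 : X) (t : nat) (w : T) : X * X :=
  match t with
  | 0%N => (x0, g0)
  | t'.+1 => page_step dot fs gamma (theta t' w) (idx t' w)
               (page dot fs gamma theta idx x0 g0 t' w)
  end.

Definition lyapunov (R : realType) (X : normedModType R)
    (dot : {dot X for @idfun R}) (f : X -> R) (p gamma a b : R)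
    (s : X * X) : R :=
  f s.1 - inf (range f) - b * gamma * `|gradient dot f s.1| ^+ 2
  + a * gamma / p * `|s.2 - gradient dot f s.1| ^+ 2
  + b * gamma / p * `|s.2| ^+ 2.

(* Main.v *)
(* Each f_i being L-smooth and tau-weakly convex, its gradient increments satisfy
   |D|^2 <= (L - tau) <D, x - y> + L tau |x - y|^2. Averaged over i and applied to
   the step x^{t+1} - x^t = -gamma g^t, this bounds the mean square of the increments
   by -2b <grad f(x^{t+1}) - grad f(x^t), g^t> + L tau gamma^2 |g^t|^2, and the inner
   product cancels the cross term in the conditional expectation of |g^{t+1}|^2:
   this is why the weights satisfy a + b = 1 with b = gamma (L - tau) / 2. The
   descent lemma, the PL inequality and the stepsize condition absorb what is left,
   so that the conditional expectation of Psi^{t+1} is at most rho Psi^t. Almost sure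
   convergence follows since Psi >= 0 and the expectations of Psi^t are summable. *)
Require Import Defs.
From mathcomp Require Import all_boot all_order all_algebra sesquilinear.
From mathcomp Require Import all_classical all_reals all_analysis.
From mathcomp Require Import measurable_realfun.
From mathcomp Require Import ring lra.
Set Implicit Arguments.
Unset Strict Implicit.
Unset Printing Implicit Defensive.
Import Order.TTheory GRing.Theory Num.Theory.
Import numFieldNormedType.Exports.
Local Open Scope classical_set_scope.
Local Open Scope ring_scope.

(** * Bilinearity and definiteness of the inner product *)

Section InnerProduct.
Variables (R : realType) (X : normedModType R) (dot : {dot X for @idfun R}).
Implicit Types (u v w : X) (c : R).

Lemma dotDl u v w : dot (u + v) w = dot u w + dot v w.
Proof. exact: linearDl. Qed.
Lemma dotDr u v w : dot u (v + w) = dot u v + dot u w.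
Proof. exact: linearDr. Qed.
Lemma dotNl u w : dot (- u) w = - dot u w.
Proof. exact: linearNl. Qed.
Lemma dotNr u w : dot u (- w) = - dot u w.
Proof. exact: linearNr. Qed.
Lemma dotZl c u w : dot (c *: u) w = c * dot u w.
Proof. exact: linearZl_LR. Qed.
Lemma dotZr c u w : dot u (c *: w) = c * dot u w.
Proof. exact: linearZr_LR. Qed.
Lemma dot_suml (I : finType) (F : I -> X) w :
  dot (\sum_i F i) w = \sum_i dot (F i) w.
Proof. exact: linear_sumlz. Qed.
Lemma dot_sumr (I : finType) (F : I -> X) w :
  dot w (\sum_i F i) = \sum_i dot w (F i).
Proof. exact: linear_sumr. Qed.
Lemma dot0l w : dot 0 w = 0.
Proof. exact: linear0l. Qed.
Lemma dotC u v : dot u v = dot v u.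
Proof. by rewrite hermC expr0 mul1r. Qed.

Definition dotE := (dotDl, dotDr, dotNl, dotNr, dotZl, dotZr).

Lemma dot_gt0 u : u != 0 -> 0 < dot u u.
Proof. exact: neq0_dnorm_gt0. Qed.

Lemma dot_ge0 u : 0 <= dot u u.
Proof.
by have [->|/dot_gt0/ltW//] := eqVneq u 0; rewrite dot0l.
Qed.

Lemma dot_inj u v : (forall w, dot u w = dot v w) -> u = v.
Proof.
move=> uv; apply/eqP; rewrite -subr_eq0; apply/negPn/negP => /dot_gt0.
by rewrite dotDl dotNl uv subrr ltxx.
Qed.

End InnerProduct.

(** * Riesz representation in finite dimension, by Gram-Schmidt *)

Section Riesz.
Variables (R : realType) (X : normedModType R) (dot : {dot X for @idfun R}).

(* The second conjunct says that [g] lies in the span of [s], without mentioning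
   coefficients. *)
Lemma riesz_on_seq (s : seq X) (l : {linear X -> R^o}) :
  exists g : X, (forall v, v \in s -> l v = dot g v) /\
    (forall h k : {linear X -> R^o},
      (forall v, v \in s -> h v = k v) -> h g = k g).
Proof.
elim: s l => [|e s IH] l.
  by exists 0; split => // h k _; rewrite !linear0.
have [g1 [g1s g1span]] := IH l.
(* [u] represents [dot e] on [s] and lies in its span: it is the orthogonal projection of [e], and
   the residual [w = e - u] is orthogonal to [s]. *)
have [u [us uspan]] := IH (dot e : {linear X -> R^o}).
have [w wE] : exists w, w = e - u by exists (e - u).
have ws v : v \in s -> dot w v = dot 0 v.
  by move=> vs; rewrite wE dotDl dotNl us// subrr dot0l.
have wspan g' : (forall h k : {linear X -> R^o},
    (forall v, v \in s -> h v = k v) -> h g' = k g') -> dot w g' = 0.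
  by move=> /(_ (dot w) (dot 0) ws) /= ->; rewrite dot0l.
exists (g1 + (l w / dot w w) *: w); split => [v|h k hk].
  rewrite inE => /orP[/eqP ->|vs]; last first.
    by rewrite dotDl dotZl g1s// (ws v)// dot0l mulr0 addr0.
  have -> : e = u + w by rewrite wE addrC subrK.
  have lu : l u = dot g1 u by exact: (uspan l (dot g1 : {linear X -> R^o})).
  rewrite linearD lu !dotDr !dotDl !dotZl (wspan u)// (dotC _ g1 w) (wspan g1)//.
  rewrite mulr0 addr0 add0r.
  (* If [e] already lies in the span, the coefficient [l w / dot w w] is a division by zero, worth
     0; this is harmless since [l w = 0]. *)
  have [->|w0] := eqVneq w 0; first by rewrite linear0 dot0l mulr0.
  by rewrite divfK ?gt_eqF ?dot_gt0.
have hks v : v \in s -> h v = k v by move=> vs; apply: hk; rewrite inE vs orbT.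
have hkw : h w = k w by rewrite wE !linearB (uspan _ _ hks) hk ?inE ?eqxx.
by rewrite !linearD !linearZ /= (g1span _ _ hks) hkw.
Qed.

Lemma riesz (l : {linear X -> R^o}) :
  finite_dimensional X -> exists g, forall v, l v = dot g v.
Proof.
move=> [m [e spanX]].
have [g [gE _]] := riesz_on_seq (codom e) l.
exists g => v; have [c ->] := spanX v.
rewrite linear_sum dot_sumr; apply: eq_bigr => k _.
by rewrite linearZ /= dotZr gE// codom_f.
Qed.

End Riesz.

(** * Gradients as Riesz representatives *)

Section Gradient.
Variables (R : realType) (X : normedModType R) (dot : {dot X for @idfun R}).
Hypothesis X_fin : finite_dimensional X.

(** The differential is a linear map, so [riesz] makes the set in [gradient] inhabited and [get]
    returns an actual representative. *)
Lemma gradientE (h : X -> R) (x v : X) : 'd h x v = dot (gradient dot h x) v.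
Proof.
have [g gE] := riesz dot ('d h x) X_fin.
by have /(_ v) := getPex (P := [set g : X | forall v, 'd h x v = dot g v])
  (ex_intro _ g gE).
Qed.

Lemma gradient_average (n : nat) (fs : 'I_n -> X -> R) (x : X) :
  (forall k, differentiable (fs k) x) ->
  gradient dot (average fs) x = n%:R^-1 *: \sum_(k < n) gradient dot (fs k) x.
Proof.
move=> dfs; apply: (@dot_inj _ _ dot) => w; rewrite -gradientE dotZl dot_suml.
have -> : average fs = n%:R^-1 *: (\sum_(k < n) fs k).
  by apply/funext => y; rewrite /average /= fct_sumE.
have dsum : differentiable (\sum_(k < n) fs k) x by exact: differentiable_sum.
rewrite -deriveE; last exact: differentiableZ.
rewrite deriveZ; last exact: diff_derivable.
rewrite derive_sum; last by move=> k; exact: diff_derivable.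
congr (_ * _); apply: eq_bigr => k _.
by rewrite deriveE// gradientE.
Qed.

End Gradient.

(** * Derivative along a line *)

Section LineDerivative.
Variables (R : realType) (X : normedModType R).

Lemma is_derive_line (h : X -> R) (x d : X) (t : R) :
  differentiable h (x + t *: d) ->
  is_derive t (1 : R) (fun s : R => h (x + s *: d)) ('d h (x + t *: d) d).
Proof.
move=> dh.
have dl : is_diff t (fun s : R => x + s *: d) (fun s => s *: d).
  by apply: is_diff_eq; rewrite add0r.
have dhl : is_diff t (h \o (fun s : R => x + s *: d))
    ('d h (x + t *: d) \o (fun s => s *: d)).
  apply: is_diff_comp; exact: differentiableP.
apply: DeriveDef; first exact/diff_derivable.
by rewrite deriveE// diff_val /= scale1r.
Qed.

End LineDerivative.

(** * Quadratic bounds and interpolation for smooth weakly convex functions *)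

Section SmoothWeaklyConvex.
Variables (R : realType) (X : normedModType R) (dot : {dot X for @idfun R}).
Hypotheses (X_hilbert : hilbert_norm dot) (X_fin : finite_dimensional X).
Variables (L tau : R) (h : X -> R).
Hypotheses (L_gt0 : 0 < L) (tau_ge0 : 0 <= tau).
Hypotheses (h_smooth : smooth dot L h) (h_wconvex : weakly_convex tau h).

Local Notation grad := (gradient dot h).

Lemma hilbert_normD (u v : X) :
  `|u + v| ^+ 2 = `|u| ^+ 2 + 2 * dot u v + `|v| ^+ 2.
Proof. by rewrite !X_hilbert !dotE (dotC _ v u); ring. Qed.

Lemma cauchy_schwarz (u v : X) : dot u v <= `|u| * `|v|.
Proof.
have [->|v0] := eqVneq v 0.
  by rewrite normr0 mulr0 dotC dot0l.
have vv : 0 < `|v| by rewrite normr_gt0.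
have [->|u0] := eqVneq u 0; first by rewrite dot0l normr0 mul0r.
have uu : 0 < `|u| by rewrite normr_gt0.
have := dot_ge0 dot (`|v| *: u - `|u| *: v).
rewrite !dotE -!X_hilbert (dotC _ v u) => H.
rewrite -(ler_pM2l (mulr_gt0 uu vv)); nra.
Qed.

(** Mean value theorem for the gap [phi] between [h] and its quadratic upper model along the
    segment: the Lipschitz gradient and Cauchy-Schwarz make the derivative of [phi] nonpositive on
    [0, 1]. *)
Lemma smooth_descent (x y : X) :
  h y <= h x + dot (grad x) (y - x) + L / 2 * `|y - x| ^+ 2.
Proof.
have [dh hL] := h_smooth.
have [d dE] : exists d, d = y - x by exists (y - x).
have yE : y = x + 1 *: d by rewrite dE scale1r addrC subrK.
rewrite -dE {1}yE.
pose phi s := h (x + s *: d) - (dot (grad x) d * s + L / 2 * `|d| ^+ 2 * s ^+ 2).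
pose dphi s := dot (grad (x + s *: d) - grad x) d - L * s * `|d| ^+ 2.
have phiD t : is_derive t (1 : R) phi (dphi t).
  have D1 := is_derive_line (dh (x + t *: d)).
  rewrite /phi; apply: is_derive_eq.
  rewrite /dphi dotDl dotNl -!gradientE//.
  move: ('d h (x + _) d) ('d h x d) => D D'.
  by rewrite /GRing.scale /= !mulr1; field.
have phi_cont : continuous phi.
  by move=> t; apply/differentiable_continuous/derivable1_diffP.
have [|c] := @MVT_segment R phi dphi 0 1 ler01 (fun t _ => phiD t).
  exact: continuous_subspaceT.
rewrite in_itv /= subr0 mulr1 /phi scale0r addr0 => /andP[c0 c1].
rewrite !mulr0 expr0n /= mulr0 !addr0 subr0 !mulr1 expr1n mulr1 => hE.
suff : dphi c <= 0 by rewrite -hE; lra.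
rewrite /dphi subr_le0 (le_trans (cauchy_schwarz _ _))//.
rewrite expr2 mulrA ler_wpM2r// (le_trans (hL _ _))//.
by rewrite addrAC subrr add0r normrZ ger0_norm// mulrA.
Qed.

(** Convexity of h + tau/2 |.|^2 bounds the difference quotients of [h] from [x] towards [y],
    uniformly over steps [t] in ]0, 1[; the limit at 0 from the right is the directional
    derivative. *)
Lemma weakly_convex_above_tangent (x y : X) :
  h x + dot (grad x) (y - x) - tau / 2 * `|y - x| ^+ 2 <= h y.
Proof.
have [dh _] := h_smooth.
have [d dE] : exists d, d = y - x by exists (y - x).
have yE : y = x + d by rewrite dE addrC subrK.
rewrite -dE.
suff : dot (grad x) d <= h y - h x + tau / 2 * `|d| ^+ 2 by lra.
have cvx t : 0 < t < 1 ->
    t^-1 * (h (x + t *: d) - h x) <= h y - h x + tau / 2 * `|d| ^+ 2.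
  move=> /andP[t0 t1].
  have : h (t *: y + (1 - t) *: x) + tau / 2 * `|t *: y + (1 - t) *: x| ^+ 2 <=
      t * (h y + tau / 2 * `|y| ^+ 2) + (1 - t) * (h x + tau / 2 * `|x| ^+ 2).
    exact: (h_wconvex (Itv01 (ltW t0) (ltW t1)) (in_setT y) (in_setT x)).
  have -> : t *: y + (1 - t) *: x = x + t *: d.
    by rewrite dE scalerBr scalerBl scale1r addrCA.
  have ny : `|y| ^+ 2 = `|x| ^+ 2 + 2 * dot x d + `|d| ^+ 2 by rewrite yE hilbert_normD.
  rewrite ny hilbert_normD dotZr normrZ exprMn -normrX (ger0_norm (sqr_ge0 _)) => cv.
  rewrite mulrC ler_pdivrMr//.
  have /= := mulr_ge0 tau_ge0 (sqr_ge0 (t * `|d|)).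
  by rewrite exprMn; lra.
have dD : derivable h x d by exact: diff_derivable.
have /cvg_dnbhs_at_right := dD.
rewrite -[X in _ --> X]/('D_d h x) deriveE// (gradientE dot)// => cvgD.
apply: (cvgr_to_le cvgD); near=> t.
rewrite /= (addrC _ x); apply: cvx; apply/andP; split; near: t.
  exact: nbhs_right_gt.
exact: nbhs_right_lt.
Unshelve. all: by end_near.
Qed.

(* Bound [h (y + w)] and [h (x - w)] from below by the tangent at one of [x], [y]
   and from above by the tangent at the other one, add up, and choose [w] optimally. *)
Lemma gradient_interpolation (x y : X) :
  `|grad x - grad y| ^+ 2 <=
  (L - tau) * dot (grad x - grad y) (x - y) + L * tau * `|x - y| ^+ 2.
Proof.
have [A AE] : exists A, A = grad x - grad y by exists (grad x - grad y).
have [d dE] : exists d, d = x - y by exists (x - y).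
(* This [w] maximizes 2 <A + tau d, w> - (L + tau) |w|^2, the quantity that the four bounds control
   from above. *)
have [w wE] : exists w, w = (L + tau)^-1 *: (A + tau *: d).
  by exists ((L + tau)^-1 *: (A + tau *: d)).
have Lt : 0 < L + tau by exact: ltr_pwDl.
have l1 := weakly_convex_above_tangent x (y + w).
have u1 := smooth_descent y (y + w).
have l2 := weakly_convex_above_tangent y (x - w).
have u2 := smooth_descent x (x - w).
have e1 : y + w - x = w - d by rewrite dE opprB addrCA addrA.
have e2 : x - w - y = d - w by rewrite dE addrAC.
have e3 : y + w - y = w by rewrite addrAC subrr add0r.
have e4 : x - w - x = - w by rewrite addrAC subrr add0r.
rewrite -AE -dE; rewrite e1 in l1; rewrite e2 in l2; rewrite e3 in u1; rewrite e4 in u2.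
have key : 2 * dot (A + tau *: d) w <=
    dot A d + tau * `|d| ^+ 2 + (L + tau) * `|w| ^+ 2.
  move: l1 u1 l2 u2; rewrite AE !hilbert_normD !normrN !dotE (dotC _ d w); lra.
have ww : dot (A + tau *: d) w = (L + tau) * `|w| ^+ 2.
  have -> : A + tau *: d = (L + tau) *: w by rewrite wE scalerA divff ?gt_eqF ?scale1r.
  by rewrite dotZl X_hilbert.
have w2E : (L + tau) ^+ 2 * `|w| ^+ 2 =
    `|A| ^+ 2 + 2 * tau * dot A d + tau ^+ 2 * `|d| ^+ 2.
  have -> : (L + tau) ^+ 2 * `|w| ^+ 2 = `|(L + tau) *: w| ^+ 2.
    by rewrite normrZ exprMn ger0_norm// ltW.
  rewrite wE scalerA divff ?gt_eqF// scale1r hilbert_normD dotZr normrZ exprMn ger0_norm//.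
  ring.
(* Multiplied by L + tau, [key] reads |A + tau d|^2 <= (L + tau) (<A, d> + tau |d|^2); expanding the
   square leaves the claim. *)
have := ler_wpM2l (ltW Lt) key; rewrite ww; nra.
Qed.

End SmoothWeaklyConvex.

(** * Averages over the component index *)

Section Average.
Variables (R : realType) (X : normedModType R) (dot : {dot X for @idfun R}).
Hypothesis X_hilbert : hilbert_norm dot.
Variables (n : nat) (n_ge1 : (1 <= n)%N).

Let n_neq0 : n%:R != 0 :> R. Proof. by rewrite pnatr_eq0 -lt0n. Qed.

Lemma average_cst (c : R) : n%:R^-1 * \sum_(k < n) c = c.
Proof. by rewrite sumr_const card_ord -[c *+ n]mulr_natl mulrA mulVf ?mul1r. Qed.

Lemma average_affine (F G : 'I_n -> R) (c : R) :
  n%:R^-1 * (\sum_(k < n) F k) + n%:R^-1 * (\sum_(k < n) G k) + c =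
  n%:R^-1 * \sum_(k < n) (F k + G k + c).
Proof. by rewrite !big_split /= !mulrDr average_cst. Qed.

Lemma average_hilbert_normD (u : X) (D : 'I_n -> X) :
  n%:R^-1 * \sum_(k < n) `|u + D k| ^+ 2 =
  `|u| ^+ 2 + 2 * dot u (n%:R^-1 *: \sum_(k < n) D k)
  + n%:R^-1 * \sum_(k < n) `|D k| ^+ 2.
Proof.
under eq_bigr do rewrite (hilbert_normD X_hilbert).
rewrite !big_split /= !mulrDr average_cst dotZr dot_sumr -!mulr_sumr.
by rewrite mulrCA.
Qed.

End Average.

(** * Scalar inequalities behind the stepsize, the weights and the rate *)

Section ScalarInequalities.
Variables (R : realType) (L tau mu p gamma : R).
Hypotheses (L_gt0 : 0 < L) (tau_ge0 : 0 <= tau) (tau_leL : tau <= L).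
Hypotheses (mu_gt0 : 0 < mu) (p_gt0 : 0 < p) (p_le1 : p <= 1) (gamma_gt0 : 0 < gamma).
Hypothesis gamma_le : gamma <=
  1 / (L * (1 + Num.sqrt (4 * tau / (L + tau)) * Num.sqrt ((1 - p) / p))).
Hypothesis gamma_lt : tau = 0 -> gamma < 1 / L.

Let a := 1 - gamma * (L - tau) / 2.
Let gamma_ge0 : 0 <= gamma := ltW gamma_gt0.
Let p_ge0 : 0 <= p := ltW p_gt0.
Let b := gamma * (L - tau) / 2.
Let rho := Num.max (1 - (1 - 2 * b) * gamma * mu) (1 - p * (1 - 1 / (2 * a))).

Lemma stepsize_sqrt : gamma * L *
  (1 + Num.sqrt (4 * tau / (L + tau)) * Num.sqrt ((1 - p) / p)) <= 1.
Proof.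
have S0 : 0 <= Num.sqrt (4 * tau / (L + tau)) * Num.sqrt ((1 - p) / p).
  by rewrite mulr_ge0 ?sqrtr_ge0.
move: gamma_le; rewrite ler_pdivlMr ?mulrA// mulr_gt0//; lra.
Qed.

Lemma stepsize_le : gamma * L <= 1.
Proof.
have S0 : 0 <= Num.sqrt (4 * tau / (L + tau)) * Num.sqrt ((1 - p) / p).
  by rewrite mulr_ge0 ?sqrtr_ge0.
have gL := mulr_gt0 gamma_gt0 L_gt0.
have := stepsize_sqrt; nra.
Qed.

(** With S the product of the two roots, the stepsize condition is gamma L S <= 1 - gamma L.
    Squaring brings in S^2 = 4 tau (1 - p) / ((L + tau) p); then (L + tau) / (4 L) <= 1/2 and (1 -
    gamma L)^2 <= 1 - gamma L conclude. *)
Lemma stepsize_variance : (1 - p) * (L * tau * gamma ^+ 2) <= p * (1 - gamma * L) / 2.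
Proof.
have := stepsize_sqrt; set S := _ * Num.sqrt ((1 - p) / p) => gS.
have Lt : 0 < L + tau by exact: ltr_pwDl.
have S2 : S ^+ 2 = 4 * tau / (L + tau) * ((1 - p) / p).
  have t0 : 0 <= 4 * tau / (L + tau) by apply: divr_ge0; [exact: mulr_ge0|exact: ltW].
  have q0 : 0 <= (1 - p) / p by apply: divr_ge0; rewrite ?subr_ge0.
  by rewrite exprMn !sqr_sqrtr.
have S0 : 0 <= S by rewrite mulr_ge0 ?sqrtr_ge0.
have gL := mulr_gt0 gamma_gt0 L_gt0.
have gL1 := stepsize_le.
have sq : (gamma * L * S) ^+ 2 <= (1 - gamma * L) ^+ 2.
  have e0 : 0 <= gamma * L * S by rewrite mulr_ge0// ltW.
  have e1 : gamma * L * S <= 1 - gamma * L by lra.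
  by rewrite !expr2; exact: ler_pM.
have -> : (1 - p) * (L * tau * gamma ^+ 2) =
    p * ((L + tau) / (4 * L)) * (gamma * L * S) ^+ 2.
  by rewrite exprMn S2; field; rewrite !gt_eqF.
have c1 : (L + tau) / (4 * L) <= 1 / 2.
  by rewrite ler_pdivrMr ?mulr_gt0//; have := tau_leL; lra.
have c0 : 0 <= (L + tau) / (4 * L).
  by apply: divr_ge0; [exact: ltW|apply: mulr_ge0 => //; exact: ltW].
have h1 : (1 - gamma * L) ^+ 2 <= 1 - gamma * L by nra.
have h2 : (L + tau) / (4 * L) * (gamma * L * S) ^+ 2 <= 1 / 2 * (1 - gamma * L).
  apply: ler_pM => //; first exact: sqr_ge0.
  exact: le_trans sq h1.
have := ler_wpM2l (ltW p_gt0) h2; lra.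
Qed.

Lemma b_ge0 : 0 <= b.
Proof. by apply: divr_ge0 => //; apply: mulr_ge0; [exact: ltW|rewrite subr_ge0]. Qed.

(** As 2 b = gamma L - gamma tau with gamma L <= 1, strictness comes from gamma tau > 0, or from the
    extra requirement when tau = 0. *)
Lemma b_lt_half : b < 1 / 2.
Proof.
have gL := stepsize_le.
have [t0|t0] := eqVneq tau 0.
  have := gamma_lt t0; rewrite ltr_pdivlMr// /b t0; lra.
have : 0 < gamma * tau by rewrite mulr_gt0// lt_neqAle eq_sym t0.
rewrite /b; lra.
Qed.

Let a_def : a = 1 - b. Proof. by []. Qed.

Lemma b_gamma_lt : b * gamma < 1 / (2 * L).
Proof.
rewrite ltr_pdivlMr ?mulr_gt0//.
have := b_lt_half; have := b_ge0; have := stepsize_le; have := mulr_gt0 gamma_gt0 L_gt0.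
nra.
Qed.

Lemma rho_gt0 : 0 < rho.
Proof.
rewrite /rho lt_max; apply/orP; right.
have := b_lt_half => bh.
have a0 : 1 / 2 < a by rewrite a_def; lra.
have : 0 < p * (1 / (2 * a)) by rewrite mulr_gt0// divr_gt0//; lra.
have := p_le1; lra.
Qed.

Lemma rho_lt1 : rho < 1.
Proof.
have bh := b_lt_half.
have a0 : 1 / 2 < a by rewrite a_def; lra.
have i1 : 1 / (2 * a) < 1 by rewrite ltr_pdivrMr; lra.
rewrite /rho gt_max; apply/andP; split.
  have : 0 < (1 - 2 * b) * gamma * mu by rewrite !mulr_gt0//; lra.
  lra.
have : 0 < p * (1 - 1 / (2 * a)) by rewrite mulr_gt0// subr_gt0.
lra.
Qed.

(* [F = f x - inf f], [A = |grad f x|^2], [V = |g - grad f x|^2], [G = |g|^2],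
   primes denote the next iterate, [D] and [m] are the squared norm of the increment
   of [grad f] and the mean squared norm of those of [grad f_i], and [c] is the
   inner product of [g] with the increment of [grad f]. *)
Lemma lyapunov_contraction (F F' A A' V G D m c : R) :
  F' <= F - gamma / 2 * A - gamma / 2 * G + gamma / 2 * V + L / 2 * gamma ^+ 2 * G ->
  m <= - (gamma * (L - tau)) * c + L * tau * gamma ^+ 2 * G ->
  A <= 2 * L * F -> 2 * mu * F <= A -> 0 <= A -> 0 <= G -> 0 <= V -> 0 <= D ->
  p * (F' - b * gamma * A' + b * gamma / p * A')
  + (1 - p) * (F' - b * gamma * A' + a * gamma / p * (V + m - D)
               + b * gamma / p * (G + 2 * c + m))
  <= rho * (F - b * gamma * A + a * gamma / p * V + b * gamma / p * G).
Proof.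
move=> descent mle AF PL A0 G0 V0 D0.
have bh := b_lt_half; have b0 := b_ge0; have bg := b_gamma_lt.
have ah : 1 / 2 < a by rewrite a_def; lra.
have F0 : 0 <= F.
  by rewrite -(pmulr_rge0 _ (mulr_gt0 (ltr0Sn R 1) L_gt0)) (le_trans A0).
have Phi0 : 0 <= F - b * gamma * A.
  have : b * gamma * A <= 1 / (2 * L) * (2 * L * F).
    by apply: ler_pM => //; [exact: mulr_ge0|exact: ltW].
  have -> : 1 / (2 * L) * (2 * L * F) = F by field; rewrite gt_eqF.
  lra.
have rho1 : 1 - (1 - 2 * b) * gamma * mu <= rho by rewrite /rho le_max lexx.
have rho2 : 1 - p * (1 - 1 / (2 * a)) <= rho by rewrite /rho le_max lexx orbT.
(* The decrease gamma/2 A splits into b gamma A, kept in the potential, and (1 - 2 b) gamma/2 A,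
   which the PL inequality turns into (1 - 2 b) gamma mu F. *)
have partF : F - gamma / 2 * A <= rho * (F - b * gamma * A).
  apply: le_trans (ler_wpM2r Phi0 rho1).
  have bgA : 0 <= b * gamma * A by exact: mulr_ge0 (mulr_ge0 b0 gamma_ge0) A0.
  have k0 : 0 <= (1 - 2 * b) * gamma by apply: mulr_ge0 => //; lra.
  have := ler_wpM2l k0 PL; have := mulr_ge0 (mulr_ge0 k0 (ltW mu_gt0)) bgA.
  nra.
have ag0 : 0 <= a * gamma / p by apply: divr_ge0 => //; apply: mulr_ge0 => //; lra.
have bg0 : 0 <= b * gamma / p by exact: divr_ge0 (mulr_ge0 b0 gamma_ge0) p_ge0.
(* Since gamma/2 is p / (2 a) times the weight a gamma / p, the left side is exactly that weighted
   [V] times the second argument of [rho]. *)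
have partV : gamma / 2 * V + (1 - p) * (a * gamma / p * V) <= rho * (a * gamma / p * V).
  have -> : gamma / 2 * V + (1 - p) * (a * gamma / p * V) =
      (1 - p * (1 - 1 / (2 * a))) * (a * gamma / p * V).
    by field; rewrite !gt_eqF//; lra.
  by apply: ler_wpM2r => //; exact: mulr_ge0.
(* The slack gamma/2 (1 - gamma L) of the descent lemma pays for the variance term through
   [stepsize_variance]; what remains of [G] contracts by 1 - p <= rho. *)
have partG : (L / 2 * gamma ^+ 2 - gamma / 2) * G
    + (1 - p) * (gamma / p * (L * tau * gamma ^+ 2 * G))
    + (1 - p) * (b * gamma / p * G) <= rho * (b * gamma / p * G).
  have i1 : 1 - p <= rho.
    apply: le_trans rho2.
    have : 0 <= p * (1 / (2 * a)) by rewrite mulr_ge0 ?divr_ge0//; lra.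
    lra.
  have := ler_wpM2r (mulr_ge0 bg0 G0) i1.
  have gpG : 0 <= gamma / p * G by rewrite mulr_ge0// divr_ge0.
  have := ler_wpM2l gpG stepsize_variance.
  have -> : gamma / p * G * (p * (1 - gamma * L) / 2) =
      - (L / 2 * gamma ^+ 2 - gamma / 2) * G.
    by field; rewrite gt_eqF.
  lra.
have gp0 : 0 <= (1 - p) * (gamma / p) by rewrite mulr_ge0 ?subr_ge0// divr_ge0.
have partm : (1 - p) * (gamma / p) * (m + 2 * b * c) <=
    (1 - p) * (gamma / p) * (L * tau * gamma ^+ 2 * G).
  apply: ler_wpM2l => //; rewrite /b; lra.
have partD : 0 <= (1 - p) * (gamma / p) * (a * D).
  by apply: mulr_ge0 => //; apply: mulr_ge0 => //; lra.
(* [A'] disappears: the first branch contributes p (b gamma / p) A', exactly what the two branches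
   subtract together. In the second branch [m] has weight (a + b) gamma / p = gamma / p. *)
have -> : p * (F' - b * gamma * A' + b * gamma / p * A')
  + (1 - p) * (F' - b * gamma * A' + a * gamma / p * (V + m - D)
               + b * gamma / p * (G + 2 * c + m)) =
  F' + (1 - p) * (a * gamma / p * V) + (1 - p) * (b * gamma / p * G)
  + (1 - p) * (gamma / p) * (m + 2 * b * c) - (1 - p) * (gamma / p) * (a * D).
  by rewrite a_def; field; rewrite gt_eqF.
lra.
Qed.

End ScalarInequalities.

(** * One step of the algorithm in conditional expectation *)

Section OneStep.
Variables (R : realType) (X : normedModType R) (dot : {dot X for @idfun R}).
Hypotheses (X_hilbert : hilbert_norm dot) (X_fin : finite_dimensional X).
Variables (n : nat) (n_ge1 : (1 <= n)%N).
Variables (L tau : R) (L_gt0 : 0 < L) (tau_ge0 : 0 <= tau) (tau_leL : tau <= L).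
Variables (fs : 'I_n -> X -> R).
Hypotheses (fs_smooth : forall k, smooth dot L (fs k))
  (fs_wconvex : forall k, weakly_convex tau (fs k))
  (f_bounded : has_lbound (range (average fs))).

Local Notation f := (average fs).
Local Notation grad := (gradient dot).

Let n_ge0 : 0 <= n%:R^-1 :> R. Proof. by rewrite invr_ge0. Qed.
Let dfs k x : differentiable (fs k) x. Proof. by case: (fs_smooth k). Qed.

Lemma average_descent (x y : X) :
  f y <= f x + dot (grad f x) (y - x) + L / 2 * `|y - x| ^+ 2.
Proof.
rewrite gradient_average// dotZl dot_suml /average.
rewrite (average_affine n_ge1 (fs ^~ x) (fun k => dot (grad (fs k) x) (y - x))).
by apply: ler_wpM2l => //; apply: ler_sum => k _; exact: smooth_descent.
Qed.

Lemma average_gradientB (x y : X) :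
  grad f x - grad f y = n%:R^-1 *: \sum_(k < n) (grad (fs k) x - grad (fs k) y).
Proof. by rewrite !gradient_average// -scalerBr sumrB. Qed.

Lemma average_interpolation (x y : X) :
  n%:R^-1 * \sum_(k < n) `|grad (fs k) x - grad (fs k) y| ^+ 2 <=
  (L - tau) * dot (grad f x - grad f y) (x - y) + L * tau * `|x - y| ^+ 2.
Proof.
have -> : (L - tau) * dot (grad f x - grad f y) (x - y) =
    n%:R^-1 * \sum_(k < n) (L - tau) * dot (grad (fs k) x - grad (fs k) y) (x - y).
  (* Rewriting with [average_gradientB] would unify the gradients of [f] and of
     [fs k] by unfolding them, which is very slow. *)
  transitivity ((L - tau) *
    dot (n%:R^-1 *: \sum_(k < n) (grad (fs k) x - grad (fs k) y)) (x - y)).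
    by congr (_ * dot _ _); exact: average_gradientB.
  by rewrite dotZl dot_suml mulrCA mulr_sumr.
have -> : n%:R^-1 * (\sum_(k < n) (L - tau) * dot (grad (fs k) x - grad (fs k) y) (x - y))
    + L * tau * `|x - y| ^+ 2 =
    n%:R^-1 * \sum_(k < n) ((L - tau) * dot (grad (fs k) x - grad (fs k) y) (x - y)
                            + L * tau * `|x - y| ^+ 2).
  by rewrite big_split /= mulrDr average_cst.
by apply: ler_wpM2l => //; apply: ler_sum => k _; exact: gradient_interpolation.
Qed.

(** A gradient step of length 1/L from [x] decreases [f] by at least |grad f x|^2 / (2 L), and
    cannot go below the infimum. *)
Lemma gradient_le_gap (x : X) : `|grad f x| ^+ 2 <= 2 * L * (f x - inf (range f)).
Proof.
have := average_descent x (x - L^-1 *: grad f x).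
have -> : x - L^-1 *: grad f x - x = - (L^-1 *: grad f x) by rewrite addrAC subrr add0r.
rewrite dotNr dotZr -X_hilbert normrN normrZ exprMn.
rewrite ger0_norm ?invr_ge0 ?(ltW L_gt0)// => H.
have : inf (range f) <= f (x - L^-1 *: grad f x).
  by apply: ge_inf => //; exists (x - L^-1 *: grad f x).
move=> /le_trans /(_ H); move: (f x) (inf _) (`|_| ^+ 2) => F I A FA.
rewrite -subr_ge0.
have -> : 2 * L * (F - I) - A = 2 * L * (F - L^-1 * A + L / 2 * (L^-1 ^+ 2 * A) - I).
  by field; rewrite gt_eqF.
apply: mulr_ge0; first by rewrite mulr_ge0// ltW.
by rewrite subr_ge0; move: FA; congr (_ <= _); ring.
Qed.

Variables (mu p gamma : R).
Hypotheses (mu_gt0 : 0 < mu) (f_PL : polyak_lojasiewicz dot mu f).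
Hypotheses (p_gt0 : 0 < p) (p_le1 : p <= 1) (gamma_gt0 : 0 < gamma).
Hypothesis gamma_le : gamma <=
  1 / (L * (1 + Num.sqrt (4 * tau / (L + tau)) * Num.sqrt ((1 - p) / p))).
Hypothesis gamma_lt : tau = 0 -> gamma < 1 / L.

Let a := 1 - gamma * (L - tau) / 2.
Let b := gamma * (L - tau) / 2.
Let rho := Num.max (1 - (1 - 2 * b) * gamma * mu) (1 - p * (1 - 1 / (2 * a))).
Local Notation lyap := (lyapunov dot f p gamma a b).

(** With [u], [w] the gradients of the drawn component and [A], [B] those of [f] at the new and old
    points, the new error is the old one, minus the mean increment, plus the sampled one. *)
Let error_update (g u w A B : X) : g + u - w - A = g - B - (A - B) + (u - w).
Proof. by rewrite opprB (addrA (g - B)) subrK addrACA -[LHS]addrA (addrC (- w)). Qed.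

Lemma lyapunov_ge0 (s : X * X) : 0 <= lyap s.
Proof.
have gle := gradient_le_gap s.1.
have bg := b_gamma_lt L_gt0 tau_ge0 tau_leL gamma_gt0 gamma_le gamma_lt.
have bh := b_lt_half L_gt0 tau_ge0 gamma_gt0 gamma_le gamma_lt.
have b0 := b_ge0 tau_leL gamma_gt0.
have a0 : 0 <= a by rewrite /a -/b; rewrite -/b in bh; lra.
have gp : 0 <= gamma / p by rewrite divr_ge0// ltW.
have quad_ge0 c (u : X) : 0 <= c -> 0 <= c * gamma / p * `|u| ^+ 2.
  by move=> c0; rewrite mulr_ge0 ?sqr_ge0// -mulrA mulr_ge0.
rewrite /lyapunov; apply: addr_ge0; last exact: quad_ge0.
apply: addr_ge0; last exact: quad_ge0.
rewrite subr_ge0.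
apply: (@le_trans _ _ (1 / (2 * L) * (2 * L * (f s.1 - inf (range f))))).
  apply: ler_pM; rewrite ?sqr_ge0//; last exact: ltW.
  by apply: mulr_ge0 => //; exact: ltW.
have -> // : 1 / (2 * L) * (2 * L * (f s.1 - inf (range f))) = f s.1 - inf (range f).
by field; rewrite gt_eqF.
Qed.

(** The left side is the expected Lyapunov value after one step from [s], over a coin of bias [p]
    and an independent uniform index. *)
Lemma page_step_contraction (s : X * X) :
  p * (n%:R^-1 * \sum_(k < n) lyap (page_step dot fs gamma true k s))
  + (1 - p) * (n%:R^-1 * \sum_(k < n) lyap (page_step dot fs gamma false k s))
  <= rho * lyap s.
Proof.
case: s => x g; have [y yE] : exists y, y = x - gamma *: g by exists (x - gamma *: g).
have [D DE] : exists D, D = grad f y - grad f x by exists (grad f y - grad f x).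
have [v vE] : exists v, v = g - grad f x by exists (g - grad f x).
pose m := n%:R^-1 * \sum_(k < n) `|grad (fs k) y - grad (fs k) x| ^+ 2.
have yx : y - x = - (gamma *: g) by rewrite yE addrAC subrr add0r.
have Davg : D = n%:R^-1 *: \sum_(k < n) (grad (fs k) y - grad (fs k) x).
  exact: etrans DE (average_gradientB y x).
have trueE : n%:R^-1 * \sum_(k < n) lyap (page_step dot fs gamma true k (x, g)) =
    f y - inf (range f) - b * gamma * `|grad f y| ^+ 2 + b * gamma / p * `|grad f y| ^+ 2.
  by rewrite /lyapunov /page_step /= -yE average_cst// subrr normr0 expr0n /= mulr0 addr0.
have falseE : n%:R^-1 * \sum_(k < n) lyap (page_step dot fs gamma false k (x, g)) =
    f y - inf (range f) - b * gamma * `|grad f y| ^+ 2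
    + a * gamma / p * (`|v| ^+ 2 + m - `|D| ^+ 2)
    + b * gamma / p * (`|g| ^+ 2 + 2 * dot g D + m).
  rewrite /lyapunov /page_step /= -yE !big_split /= !mulrDr !average_cst// -!mulr_sumr.
  rewrite [n%:R^-1 * (a * _ / p * _)]mulrCA [n%:R^-1 * (b * _ / p * _)]mulrCA.
  congr (_ + _ + _); rewrite -!mulrDr; congr (_ * _).
    (* The new error is v - D plus an increment of mean [D], so its second moment is |v - D|^2 + 2
       <v - D, D> + m = |v|^2 + m - |D|^2. *)
    under eq_bigr => k _.
      have -> : g + grad (fs k) y - grad (fs k) x - grad f y =
          (v - D) + (grad (fs k) y - grad (fs k) x).
        by rewrite vE DE; exact: error_update.
      over.
    rewrite (average_hilbert_normD X_hilbert)// -Davg -/m.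
    have -> : `|v| ^+ 2 = `|v - D| ^+ 2 + 2 * dot (v - D) D + `|D| ^+ 2.
      by rewrite -(hilbert_normD X_hilbert) subrK.
    by rewrite [RHS]addrAC addrK.
  under eq_bigr do rewrite -addrA.
  by rewrite (average_hilbert_normD X_hilbert)// -Davg.
rewrite trueE falseE /lyapunov /= -vE.
(* Polarization trades the term - gamma <grad f x, g> of the descent lemma for gamma/2 (|v|^2 -
   |g|^2 - |grad f x|^2). *)
have vexp : `|v| ^+ 2 = `|g| ^+ 2 - 2 * dot (grad f x) g + `|grad f x| ^+ 2.
  by rewrite vE (hilbert_normD X_hilbert) dotNr normrN (dotC _ g); ring.
have yxn : `|y - x| ^+ 2 = gamma ^+ 2 * `|g| ^+ 2.
  by rewrite yx normrN normrZ exprMn ger0_norm// ltW.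
apply: (lyapunov_contraction L_gt0) => //.
- have := average_descent x y; rewrite vexp yxn yx dotNr dotZr; lra.
- have := average_interpolation y x; rewrite -/m yxn yx -DE dotNr dotZr (dotC _ D); lra.
exact: gradient_le_gap.
Qed.

End OneStep.

(** * Finite histories of the random draws *)

Section History.
Variables (T : Type) (n : nat) (theta : nat -> T -> bool) (idx : nat -> T -> 'I_n).

Definition draw t w : bool * 'I_n := (theta t w, idx t w).
(** The draws of steps 0 to t - 1: a variable with finitely many values which, with the initial
    points, determines the state at time [t]. *)
Definition history t w : seq (bool * 'I_n) := mkseq (draw ^~ w) t.

Lemma historyS t w : history t.+1 w = rcons (history t w) (draw t w).
Proof. by rewrite /history mkseqS. Qed.

End History.
Arguments history : simpl never.

(** * Law of the history and integration against it *)

Section PageNoise.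
Variables (R : realType) (d : measure_display) (T : measurableType d)
  (P : probability T R) (p : R) (n : nat).
Hypothesis n_ge1 : (1 <= n)%N.
Variables (theta : nat -> T -> bool) (idx : nat -> T -> 'I_n).
Hypothesis noise : page_noise P p theta idx.

Local Notation Z := (bool * 'I_n)%type.

Local Notation draw := (draw theta idx).
Local Notation history := (history theta idx).

Definition weight (z : Z) : R := (if z.1 then p else 1 - p) * n%:R^-1.

Fixpoint histories t : seq (seq Z) :=
  if t is t'.+1 then [seq rcons h z | h <- histories t', z <- enum {: Z}]
  else [:: [::]].

Lemma size_histories t h : h \in histories t -> size h = t.
Proof.
elim: t h => [h|t IH h /=]; first by rewrite inE => /eqP ->.
by move=> /allpairsP[[h' z] /= [/IH sh' _ ->]]; rewrite size_rcons sh'.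
Qed.

Lemma sum_histories (V : nmodType) (F : seq Z -> V) t :
  \sum_(h <- histories t.+1) F h = \sum_(h <- histories t) \sum_z F (rcons h z).
Proof.
rewrite /= big_allpairs_dep; apply: eq_bigr => h _.
by rewrite big_enum.
Qed.

Lemma sum_weight (F : Z -> R) : \sum_z weight z * F z =
  p * (n%:R^-1 * \sum_(k < n) F (true, k))
  + (1 - p) * (n%:R^-1 * \sum_(k < n) F (false, k)).
Proof.
have -> : \sum_z weight z * F z = \sum_b \sum_k weight (b, k) * F (b, k).
  by rewrite pair_bigA; apply: eq_bigr => -[].
rewrite big_bool /=.
by congr (_ + _); rewrite mulrA mulr_sumr.
Qed.

Lemma measurable_theta t b : measurable [set w | theta t w = b].
Proof.
by case: noise => [mth _]; apply: (mth t); exists [set b] => //; rewrite setTI.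
Qed.

Lemma measurable_idx t k : measurable [set w | idx t w = k].
Proof.
by case: noise => [_ [mid _]]; apply: (mid t); exists [set k] => //; rewrite setTI.
Qed.

Lemma prob_theta t b : P [set w | theta t w = b] = (if b then p else 1 - p)%:E.
Proof.
case: noise => [_ [_ [Pth _]]]; case: b; first exact: Pth.
have -> : [set w | theta t w = false] = ~` [set w | theta t w = true].
  by apply/seteqP; split => w /=; case: (theta t w).
by rewrite probability_setC ?Pth//; exact: measurable_theta.
Qed.

(** A prescribed history is an intersection of 2t events, one per coin and one per index, to which
    mutual independence applies. *)
Lemma prob_history t h : size h = t ->
  P [set w | history t w = h] = (\prod_(z <- h) weight z)%:E.
Proof.
move=> sh; pose z0 : Z := (true, Ordinal n_ge1).
pose A (j : nat + nat) : set T := match j with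
  | inl s => [set w | theta s w = (nth z0 h s).1]
  | inr s => [set w | idx s w = (nth z0 h s).2] end.
pose J : seq (nat + nat) := [seq inl s | s <- iota 0 t] ++ [seq inr s | s <- iota 0 t].
have uJ : uniq J.
  rewrite cat_uniq !map_inj_uniq ?iota_uniq; try by move=> ? ? [].
  by rewrite andbT /=; apply/hasPn => _ /mapP[s _ ->]; apply/mapP => -[].
have FA j : j \in J -> page_sigma theta idx j (A j).
  case: j => s _.
    by exists [set (nth z0 h s).1] => //; rewrite setTI.
  by exists [set (nth z0 h s).2] => //; rewrite setTI.
have -> : [set w | history t w = h] = \bigcap_(j in [set` J]) A j.
  apply/seteqP; split => w /=.
    move=> hw [] s; rewrite /= mem_cat => /orP[] /mapP[s'] // + [->];
      rewrite mem_iota add0n => /andP[_ st] /=;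
      by rewrite -hw /history nth_mkseq.
  move=> Aw; apply: (@eq_from_nth _ z0); rewrite size_mkseq//.
  move=> s st; rewrite nth_mkseq// /draw.
  have sJ1 : inl s \in J.
    by rewrite mem_cat map_f// mem_iota add0n.
  have sJ2 : inr s \in J.
    by rewrite mem_cat (map_f (inr : nat -> nat + nat)) ?orbT// mem_iota add0n.
  by have /= -> := Aw _ sJ1; have /= -> := Aw _ sJ2; case: (nth z0 h s).
case: noise => [_ [_ [_ [Pid indep]]]].
rewrite indep// big_cat !big_map /=.
rewrite (eq_bigr (fun s => (if (nth z0 h s).1 then p else 1 - p)%:E)); last first.
  by move=> s _; exact: prob_theta.
rewrite [X in (_ * X)%E](eq_bigr (fun s => (n%:R^-1)%:E)); last by move=> s _; exact: Pid.
rewrite !prodEFin -EFinM -big_split /=; congr EFin.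
by rewrite [RHS](big_nth z0) sh /index_iota subn0.
Qed.

Lemma measurable_history t h : measurable [set w | history t w = h].
Proof.
elim: t h => [h|t IH h].
  have [->|h0] := eqVneq h [::].
    by rewrite (_ : [set _ | _] = setT)//; apply/seteqP; split.
  by rewrite (_ : [set _ | _] = set0)//; apply/seteqP; split => // w /=
    /esym/eqP; rewrite (negbTE h0).
case/lastP: h => [|h [b k]].
  by rewrite (_ : [set _ | _] = set0)//; apply/seteqP; split.
rewrite (_ : [set _ | _] = [set w | history t w = h] `&`
  ([set w | theta t w = b] `&` [set w | idx t w = k])).
  apply: measurableI; first exact: IH.
  by apply: measurableI; [exact: measurable_theta|exact: measurable_idx].
apply/seteqP; split => w /=.
  by rewrite historyS => /rcons_inj[-> -> ->].
by move=> [<- [<- <-]]; exact: historyS.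
Qed.

(** Exactly one enumerated sequence matches the actual history. This finite combination of
    indicators is what gives measurability and integrals of functions of the history. *)
Lemma history_decomp (G : seq Z -> R) t w :
  G (history t w) = \sum_(h <- histories t) G h * \1_[set w | history t w = h] w.
Proof.
under eq_bigr do rewrite indicE.
elim: t G => [|t IH] G.
  by rewrite /= big_seq1 mem_set// mulr1.
rewrite sum_histories historyS (IH (fun h => G (rcons h (draw t w)))).
apply: eq_bigr => h _.
rewrite (bigD1 (draw t w))//= big1 => [|z zw].
  rewrite addr0; congr (_ * (nat_of_bool _)%:R); apply/idP/idP; rewrite !inE /= historyS.
    by move=> ->.
  by move=> /rcons_inj[].
rewrite (_ : (w \in _) = false) ?mulr0//; apply/negP; rewrite inE /= historyS.
by move=> /rcons_inj[_ wz]; rewrite wz eqxx in zw.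
Qed.

Lemma measurable_fun_history (G : seq Z -> R) t :
  measurable_fun setT (fun w => G (history t w)).
Proof.
rewrite (_ : (fun _ => _) =
  fun w => \sum_(h <- histories t) G h * \1_[set w | history t w = h] w); last first.
  by apply/funext => w; exact: history_decomp.
apply: measurable_sum => h; apply: measurable_funM => //.
by apply: measurable_indic; exact: measurable_history.
Qed.

Lemma integral_history (G : seq Z -> R) t : (forall h, 0 <= G h) ->
  (\int[P]_w (G (history t w))%:E)%E =
  (\sum_(h <- histories t) G h * \prod_(z <- h) weight z)%:E.
Proof.
move=> G0; under eq_integral do rewrite history_decomp -sumEFin.
rewrite ge0_integral_sum//; last 2 first.
- move=> h; apply/measurable_EFinP/measurable_funM => //.
  by apply: measurable_indic; exact: measurable_history.
- by move=> h w _; rewrite lee_fin mulr_ge0.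
(* Membership in [histories] is retained because [prob_history] needs the length of [h]. *)
rewrite -sumEFin big_seq [RHS]big_seq; apply: eq_bigr => h /size_histories sh.
under eq_integral do rewrite EFinM.
rewrite ge0_integralZl//; last 2 first.
- apply/measurable_EFinP/measurable_indic; exact: measurable_history.
- by rewrite lee_fin.
rewrite integral_indic//; last exact: measurable_history.
by rewrite setIT EFinM; congr (_ * _)%E; exact: prob_history.
Qed.

End PageNoise.

(** By the geometric bound and Tonelli, the series of the [Y t] is integrable, hence finite almost
    everywhere, and the terms of a convergent series tend to 0. *)
Lemma ae_cvg0_of_summable_integral (d : measure_display) (T : measurableType d)
    (R : realType) (P : {measure set T -> \bar R}) (Y : nat -> T -> R) (c r : R) :
  (forall t, measurable_fun setT (Y t)) -> (forall t w, 0 <= Y t w) ->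
  0 <= r < 1 -> (forall t, (\int[P]_w (Y t w)%:E <= (r ^+ t * c)%:E)%E) ->
  {ae P, forall w, Y t w @[t --> \oo] --> (0 : R)}.
Proof.
move=> mY Y0 /andP[r0 r1] Yc.
have geom : (\sum_(0 <= t <oo) (geometric c r t)%:E < +oo)%E.
  have cv : cvgn (series (geometric c r)).
    by apply: is_cvg_geometric_series; rewrite ger0_norm.
  have -> : (\sum_(0 <= t <oo) (geometric c r t)%:E)%E = (limn (series (geometric c r)))%:E.
    rewrite -EFin_lim//; congr (limn _); apply/funext => m /=.
    by rewrite sumEFin.
  by rewrite ltry.
have sumY : (\sum_(0 <= t <oo) \int[P]_w (Y t w)%:E < +oo)%E.
  apply: le_lt_trans geom; apply: lee_nneseries => [t _ _|t _].
    by apply: integral_ge0 => w _; rewrite lee_fin.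
  by apply: le_trans (Yc t) _; rewrite lee_fin /geometric /= mulrC.
have mYE t : measurable_fun setT (fun w => (Y t w)%:E) by exact/measurable_EFinP.
have intY : P.-integrable setT (fun w => \sum_(0 <= t <oo) (Y t w)%:E)%E.
  apply/integrableP; split.
    by apply: ge0_emeasurable_sum => // t w _ _; rewrite lee_fin.
  under eq_integral => w _.
    rewrite gee0_abs; last by apply: nneseries_ge0 => t _ _; rewrite lee_fin.
    over.
  by rewrite integral_nneseries// => t w _; rewrite lee_fin.
have := integrable_ae measurableT intY.
apply: filterS => w /(_ Logic.I); rewrite ge0_fin_numE; last first.
  by apply: nneseries_ge0 => t _ _; rewrite lee_fin.
by move=> /(nnseries_is_cvg (Y0^~ w))/cvg_series_cvg_0.
Qed.

(** * Expectations along the iterates *)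

Section PageExpectation.
Variables (R : realType) (X : normedModType R) (dot : {dot X for @idfun R}).
Variables (n : nat) (fs : 'I_n -> X -> R) (gamma p : R).

Definition page_history : X * X -> seq (bool * 'I_n) -> X * X :=
  foldl (fun s z => page_step dot fs gamma z.1 z.2 s).

Lemma pageE (T : Type) (theta : nat -> T -> bool) (idx : nat -> T -> 'I_n)
    (x0 g0 : X) t w :
  page dot fs gamma theta idx x0 g0 t w =
  page_history (x0, g0) (history theta idx t w).
Proof.
elim: t => [//|t IH].
by rewrite historyS /page_history foldl_rcons -/page_history -IH.
Qed.

(** Finite form of the tower property: for each past [h], the weighted sum over the last draw is a
    conditional expectation, bounded by the one-step hypothesis. *)
Lemma histories_contraction (Phi : X * X -> R) (r : R) (s0 : X * X) t :
  0 <= p <= 1 -> 0 <= r ->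
  (forall s,
    p * (n%:R^-1 * \sum_(k < n) Phi (page_step dot fs gamma true k s))
    + (1 - p) * (n%:R^-1 * \sum_(k < n) Phi (page_step dot fs gamma false k s))
    <= r * Phi s) ->
  \sum_(h <- histories n t) Phi (page_history s0 h) * \prod_(z <- h) weight p z
  <= r ^+ t * Phi s0.
Proof.
move=> /andP[p0 p1] r0 step; elim: t => [|t IH].
  by rewrite big_seq1 big_nil mulr1 expr0 mul1r.
have weight_ge0 (z : bool * 'I_n) : 0 <= weight p z.
  by rewrite /weight mulr_ge0 ?invr_ge0//; case: z.1; rewrite ?subr_ge0.
rewrite sum_histories exprS -mulrA.
apply: le_trans (ler_wpM2l r0 IH); rewrite mulr_sumr.
apply: ler_sum => h _.
rewrite mulrA.
have W0 : 0 <= \prod_(z <- h) weight p z by apply: prodr_ge0.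
have := ler_wpM2r W0 (step (page_history s0 h)).
apply: le_trans; rewrite -(sum_weight p
  (fun z => Phi (page_step dot fs gamma z.1 z.2 (page_history s0 h)))).
rewrite mulr_suml le_eqVlt; apply/orP; left; apply/eqP; apply: eq_bigr => z _.
rewrite /page_history foldl_rcons big_rcons /=; ring.
Qed.

End PageExpectation.

Theorem theorem2p1 (R : realType) (X : normedModType R)
    (dot : {dot X for @idfun R})
    (X_hilbert : hilbert_norm dot) (X_fin : finite_dimensional X)
    (n : nat) (n_ge1 : (1 <= n)%N)
    (L tau : R) (L_gt0 : 0 < L) (tau_ge0 : 0 <= tau) (tau_leL : tau <= L)
    (fs : 'I_n -> X -> R)
    (fs_smooth : forall k, smooth dot L (fs k))
    (fs_wconvex : forall k, weakly_convex tau (fs k))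
    (f_bounded : has_lbound (range (average fs)))
    (mu : R) (mu_gt0 : 0 < mu)
    (f_PL : polyak_lojasiewicz dot mu (average fs))
    (p : R) (p_gt0 : 0 < p) (p_le1 : p <= 1)
    (gamma : R) (gamma_gt0 : 0 < gamma)
    (gamma_le : gamma <=
      1 / (L * (1 + Num.sqrt (4 * tau / (L + tau)) * Num.sqrt ((1 - p) / p))))
    (gamma_lt : tau = 0 -> gamma < 1 / L)
    (d : measure_display) (T : measurableType d) (P : probability T R)
    (theta : nat -> T -> bool) (idx : nat -> T -> 'I_n)
    (noise : page_noise P p theta idx)
    (x0 g0 : X) :
  let f := average fs in
  let a := 1 - gamma * (L - tau) / 2 in
  let b := gamma * (L - tau) / 2 in
  let Psi t w :=
    lyapunov dot f p gamma a b (page dot fs gamma theta idx x0 g0 t w) in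
  let Psi0 := lyapunov dot f p gamma a b (x0, g0) in
  let rho := Num.max (1 - (1 - 2 * b) * gamma * mu)
                     (1 - p * (1 - 1 / (2 * a))) in
  (1 / 2 < a /\ a <= 1) /\
  (0 <= b /\ b < 1 / 2) /\
  b * gamma < 1 / (2 * L) /\
  rho < 1 /\
  (forall t, ('E_P[Psi t] <= (rho ^+ t * Psi0)%:E)%E) /\
  {ae P, forall w, Psi t w @[t --> \oo] --> (0 : R)}.
Proof.
move=> f a b Psi Psi0 rho.
have bh : b < 1 / 2.
  exact: (b_lt_half L_gt0 tau_ge0 gamma_gt0 gamma_le gamma_lt).
have b0 : 0 <= b by exact: b_ge0.
have rho1 : rho < 1.
  exact: (rho_lt1 L_gt0 tau_ge0 mu_gt0 p_gt0 gamma_gt0 gamma_le gamma_lt).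
have rho0 : 0 < rho.
  exact: (rho_gt0 mu L_gt0 tau_ge0 p_gt0 p_le1 gamma_gt0 gamma_le gamma_lt).
pose Phi := lyapunov dot f p gamma a b.
have Phi_ge0 s : 0 <= Phi s.
  exact: (lyapunov_ge0 X_hilbert X_fin n_ge1 L_gt0 tau_ge0 tau_leL fs_smooth).
(* [Psi t] depends on the sample point only through the history, so its measurability and
   expectation reduce to finite sums over [histories]. *)
pose H h := Phi (page_history dot fs gamma (x0, g0) h).
have PsiE t w : Psi t w = H (history theta idx t w) by rewrite /Psi pageE.
have mPsi t : measurable_fun setT (Psi t).
  rewrite (_ : Psi t = fun w => H (history theta idx t w)).
    exact: (measurable_fun_history noise H).
  by apply/funext => w; exact: PsiE.
have EPsi t : (\int[P]_w (Psi t w)%:E <= (rho ^+ t * Psi0)%:E)%E.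
  under eq_integral do rewrite PsiE.
  rewrite (integral_history n_ge1 noise t (G := H)) ?lee_fin; last first.
    by move=> h; exact: Phi_ge0.
  apply: histories_contraction; [by rewrite ltW|exact: ltW|move=> s].
  exact: page_step_contraction.
split; first by rewrite /a -/b; split; lra.
split; first by split.
split; first exact: (b_gamma_lt L_gt0 tau_ge0 tau_leL gamma_gt0 gamma_le gamma_lt).
split; first exact: rho1.
split; first by move=> t; rewrite unlock; exact: EPsi.
apply: (@ae_cvg0_of_summable_integral _ _ _ _ Psi Psi0 rho) => //.
- by move=> t w; rewrite PsiE; exact: Phi_ge0.
- by rewrite ltW.
Qed.
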